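(* Consider the nested risk-averse multistage stochastic program $$\min_{A_1x_1\ge b_1} c_1x_1+\sup_{\mathbb P_2\in\mathcal D^2}\mathbb E_{\mathbb P_2}\Big[\min_{A_2x_2\ge b_2-B_2x_1}c_2x_2+\cdots+\sup_{\mathbb P_T\in\mathcal D^T}\mathbb E_{\mathbb P_T}\big[\min_{A_Tx_T\ge b_T-B_Tx_{T-1}}c_Tx_T\big]\Big],$$ where $(c_t,b_t,A_t,B_t)=(c_t(\xi_t),b_t(\xi_t),A_t(\xi_t),B_t(\xi_t))$ for $t=2,\dots,T$, with the data and ambiguity sets $\mathcal D^t$ described in the context. This program is equivalent to $$\min_{x_1,u_1}\big\{c_1x_1+(1-P_2^{\ell})u_1+\mathcal Q_2(x_1,u_1)\;:\;A_1x_1\ge b_1,\ u_1\in\mathbb R\big\},$$ where, for $t=2,\dots,T$, $$Q_t(x_{t-1},\xi_t)=\inf_{x_t,\,u_t\in\mathbb R}\big\{c_t(\xi_t)x_t+(1-P_{t+1}^{\ell})u_t+\mathcal Q_{t+1}(x_t,u_t)\;:\;A_t(\xi_t)x_t\ge b_t(\xi_t)-B_t(\xi_t)x_{t-1}\big\},$$ and, for $t=1,\dots,T-1$, $$\mathcal Q_{t+1}(x_t,u_t)=P_{t+1}^{\ell}\,\mathbb E_{\xi_{t+1}\sim\mathbb P_{t+1}^{\ell}}\big[Q_{t+1}(x_t,\xi_{t+1})\big]+(P_{t+1}^{u}-P_{t+1}^{\ell})\,\mathbb E_{\xi_{t+1}\sim\mathbb P_{t+1}^{u-\ell}}\big[Q_{t+1}(x_t,\xi_{t+1})-u_t\big]^+,$$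 with $\mathcal Q_{T+1}(\cdot)=0$ and $P_{T+1}^u=P_{T+1}^{\ell}=1$. Moreover, for each $t=2,\dots,T$ the worst-case expectation satisfies $$\sup_{\mathbb P_t\in\mathcal D^t}\mathbb E_{\xi_t\sim\mathbb P_t}[Q_t(x_{t-1},\xi_t)]=P_t^{\ell}\,\mathbb E_{\xi_t\sim\mathbb P_t^{\ell}}[Q_t(x_{t-1},\xi_t)]+(1-P_t^{\ell})\,\mathrm{CVaR}^{\xi_t\sim\mathbb P_t^{u-\ell}}_{(P_t^u-1)/(P_t^u-P_t^{\ell})}[Q_t(x_{t-1},\xi_t)].$$
   Context: The planning horizon is $T\ge 2$. First-stage data $c_1,b_1,A_1$ are deterministic. For each $t=2,\dots,T$ the random parameter $\xi_t$ takes values in a finite set $\Omega_t=\{\xi_t^1,\dots,\xi_t^R\}$, and the data process is stagewise independent. A probability distribution on $\Omega_t$ is identified with a vector $f=(f^1,\dots,f^R)$. Given a reference distribution $f_0$ (for stage $t$; the stage index is suppressed) and a tolerance $d_t$, the ambiguity set is $$\mathcal D^t=\Big\{f\ge 0:\ \|f-f_0\|_\infty\le d_t,\ \sum_{r=1}^R f^r=1\Big\}.$$ Set $f_\ell=f_0-d_t$ and $f_u=f_0+d_t$ (componentwise), with $f_\ell\ge 0$, and $P_t^{\ell}=\sum_{r=1}^R f_\ell^r$, $P_t^{u}=\sum_{r=1}^R f_u^r$. It is assumed that $P_t^{\ell}\in(0,1)$ and $P_t^{u}>1$. $\mathbb P_t^{\ell}$ and $\mathbb P_t^{u-\ell}$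 are the probability measures on $\Omega_t$ induced by $f_\ell$ and $f_u-f_\ell$, i.e. with weights $f_\ell^r/P_t^{\ell}$ and $(f_u^r-f_\ell^r)/(P_t^u-P_t^\ell)$. Standing assumption: the program has compact feasible set and relatively complete recourse, and the recourse function at each stage is bounded for each decision $x$. Notation: $[a]^+=\max\{a,0\}$. For a random variable $Z$ under a probability measure $\mathbb P$ and $\alpha\in(0,1)$, $\mathrm{CVaR}_\alpha^{\mathbb P}[Z]=\inf_{u\in\mathbb R}\{u+\frac{1}{1-\alpha}\mathbb E_{\mathbb P}[Z-u]^+\}$. ''Equivalent'' means that the two programs have the same optimal value and the same optimal first-stage decisions $x_1$, and that $Q_t(x_{t-1},\xi_t)$ equals the optimal value of the nested program from stage $t$ onwards given $x_{t-1}$ and $\xi_t$. *)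

(* Defs.v *)
From HB Require Import structures.
From mathcomp Require Import all_boot all_order all_algebra.
From mathcomp Require Import all_classical all_reals all_analysis.

Set Implicit Arguments.
Unset Strict Implicit.
Unset Printing Implicit Defensive.

Import Order.TTheory GRing.Theory Num.Theory.
Import numFieldNormedType.Exports.

Local Open Scope classical_set_scope.
Local Open Scope ring_scope.

(* A x >= b, componentwise *)
Definition geq_cV (R : realType) (m n : nat) (A : 'M[R]_(m, n)) (x : 'cV[R]_n)
    (b : 'cV[R]_m) : Prop :=
  forall i, b i 0 <= (A *m x) i 0.

Definition dot (R : realType) (n : nat) (c : 'rV[R]_n) (x : 'cV[R]_n) : R :=
  (c *m x) 0 0.

(* Finite outcome spaces are identified with their index set 'I_K, and measures
   on them with weight vectors; random variables may be extended-real-valued. *)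
Definition expect (R : realType) (K : nat) (p : 'rV[R]_K)
    (Z : 'I_K -> \bar R) : \bar R :=
  (\sum_(r < K) (p 0 r)%:E * Z r)%E.

Definition pospart (R : realType) (z : \bar R) : \bar R := maxe z 0%E.

Definition CVaR (R : realType) (K : nat) (alpha : R) (p : 'rV[R]_K)
    (Z : 'I_K -> \bar R) : \bar R :=
  ereal_inf [set (u%:E + ((1 - alpha)^-1)%:E *
    expect p (fun r => pospart (Z r - u%:E)))%E | u in [set: R]].

Definition optval (R : realType) (X : Type) (S : set X) (F : X -> \bar R)
    : \bar R := ereal_inf (F @` S).

Definition argmin (R : realType) (X : Type) (S : set X) (F : X -> \bar R)
    : set X := [set x | S x /\ forall y, S y -> (F x <= F y)%E].

(* Data of the program. Stages are the t with 1 <= t <= T; fields indexed by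
   other values of t are never used. The outcome xi_t^r is represented by its
   index r, so c t r stands for c_t(xi_t^r), and likewise for b, A, B; in stages
   t >= 2 the data and the reference distribution f0 t do not depend on the
   history, which is stagewise independence. *)
Record program (R : realType) := Program {
  horizon : nat;
  nscen : nat;
  dimx : nat -> nat;
  dimb : nat -> nat;
  c1 : 'rV[R]_(dimx 1);
  b1 : 'cV[R]_(dimb 1);
  A1 : 'M[R]_(dimb 1, dimx 1);
  cost : forall t, 'I_nscen -> 'rV[R]_(dimx t);
  rhs : forall t, 'I_nscen -> 'cV[R]_(dimb t);
  Amx : forall t, 'I_nscen -> 'M[R]_(dimb t, dimx t);
  Bmx : forall t, 'I_nscen -> 'M[R]_(dimb t, dimx t.-1);
  f0 : nat -> 'rV[R]_nscen;
  tol : nat -> R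
}.

Arguments cost {R} p t r.
Arguments rhs {R} p t r.
Arguments Amx {R} p t r.
Arguments Bmx {R} p t r.

Section Program.
Variables (R : realType) (P : program R).

Local Notation T := (horizon P).
Local Notation K := (nscen P).
Local Notation decision t := ('cV[R]_(dimx P t)).

Definition X1 : set (decision 1) := [set x | geq_cV (A1 P) x (b1 P)].

Definition Xset (t : nat) (x : decision t.-1) (r : 'I_K) : set (decision t) :=
  [set y | geq_cV (Amx P t r) y (rhs P t r - Bmx P t r *m x)].

(* Stage-t decisions occurring along some scenario path on which all the
   constraints of stages 1, ..., t hold. *)
Inductive feasible : forall t : nat, decision t -> Prop :=
| feasible1 (x : decision 1) : X1 x -> feasible x
| feasibleS (t : nat) (x : decision t.-1) (r : 'I_K) (y : decision t) :
    (2 <= t <= T)%N -> feasible x -> Xset x r y -> feasible y.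

(* The norm on row vectors is the sup norm. *)
Definition ambiguity (t : nat) : set 'rV[R]_K :=
  [set f : 'rV[R]_K | [/\ forall r, 0 <= f 0 r, `|f - f0 P t| <= tol P t
             & \sum_(r < K) f 0 r = 1]].

Definition worst (t : nat) (Z : 'I_K -> \bar R) : \bar R :=
  ereal_sup [set expect f Z | f in ambiguity t].

Definition fl (t : nat) : 'rV[R]_K := f0 P t - const_mx (tol P t).
Definition fu (t : nat) : 'rV[R]_K := f0 P t + const_mx (tol P t).

(* Beyond the horizon the value is 1 by convention. *)
Definition Pl (t : nat) : R := if (t <= T)%N then \sum_(r < K) fl t 0 r else 1.
Definition Pu (t : nat) : R := if (t <= T)%N then \sum_(r < K) fu t 0 r else 1.

Definition probl (t : nat) : 'rV[R]_K := (Pl t)^-1 *: fl t.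
Definition probul (t : nat) : 'rV[R]_K := (Pu t - Pl t)^-1 *: (fu t - fl t).

Local Open Scope ereal_scope.

(* Value of the nested program from stage t onwards, given x_{t-1} and xi_t,
   when k further stages follow stage t. *)
Fixpoint nestedV_rec (k t : nat) (x : decision t.-1) (r : 'I_K) : \bar R :=
  optval (Xset x r) (fun y : decision t => (dot (cost P t r) y)%:E +
    (if k is k'.+1 then worst t.+1 (@nestedV_rec k' t.+1 y) else 0)).

Definition nestedV (t : nat) : decision t.-1 -> 'I_K -> \bar R :=
  @nestedV_rec (T - t) t.

Definition nested_obj (x1 : decision 1) : \bar R :=
  (dot (c1 P) x1)%:E + worst 2 (@nestedV 2 x1).

(* The right-hand side defining the cost-to-go of (x_{t-1}, u_{t-1}) from the
   stage-t values Z = Q_t(x_{t-1}, .). *)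
Definition togo (t : nat) (Z : 'I_K -> \bar R) (u : R) : \bar R :=
  (Pl t)%:E * expect (probl t) Z +
  (Pu t - Pl t)%:E * expect (probul t) (fun r => pospart (Z r - u%:E)).

Fixpoint Q_rec (k t : nat) (x : decision t.-1) (r : 'I_K) : \bar R :=
  optval (Xset x r `*` [set: R]) (fun yu : decision t * R =>
    (dot (cost P t r) yu.1)%:E + ((1 - Pl t.+1) * yu.2)%:E +
    (if k is k'.+1 then togo t.+1 (@Q_rec k' t.+1 yu.1) yu.2 else 0)).

Definition Q (t : nat) : decision t.-1 -> 'I_K -> \bar R := @Q_rec (T - t) t.

(* calQ t x u is the cost-to-go of (x_{t-1}, u_{t-1}); it is 0 for t = T + 1. *)
Definition calQ (t : nat) (x : decision t.-1) (u : R) : \bar R :=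
  if (t <= T)%N then togo t (@Q t x) u else 0.

Definition reform_obj (xu : decision 1 * R) : \bar R :=
  (dot (c1 P) xu.1)%:E + ((1 - Pl 2) * xu.2)%:E + @calQ 2 xu.1 xu.2.

(* The recursions that Q and nestedV are meant to satisfy. *)
Lemma QE (t : nat) (x : decision t.-1) (r : 'I_K) : (t <= T)%N ->
  @Q t x r = optval (Xset x r `*` [set: R]) (fun yu : decision t * R =>
    (dot (cost P t r) yu.1)%:E + ((1 - Pl t.+1) * yu.2)%:E +
    @calQ t.+1 yu.1 yu.2).
Proof.
move=> tT; rewrite /Q; case E : (T - t)%N => [|k] /=; congr (optval _ _);
  apply/funext => -[y u] /=; rewrite /calQ.
  by rewrite ltnNge -subn_eq0 E.
by rewrite -subn_gt0 E /= /Q subnS E.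
Qed.

Lemma nestedVE (t : nat) (x : decision t.-1) (r : 'I_K) : (t < T)%N ->
  @nestedV t x r = optval (Xset x r) (fun y : decision t =>
    (dot (cost P t r) y)%:E + worst t.+1 (@nestedV t.+1 y)).
Proof. by move=> tT; rewrite /nestedV -[(T - t)%N]prednK ?subn_gt0// subnS. Qed.

Lemma nestedV_horizon (x : decision T.-1) (r : 'I_K) :
  @nestedV T x r = optval (Xset x r) (fun y : decision T =>
    (dot (cost P T r) y)%:E).
Proof.
rewrite /nestedV subnn /=; congr (optval _ _); apply/funext => y.
by rewrite adde0.
Qed.

End Program.

Arguments X1 {R} P.
Arguments Xset {R} P t x r.
Arguments feasible {R} P t x.
Arguments ambiguity {R} P t.
Arguments worst {R} P t Z.
Arguments fl {R} P t.
Arguments fu {R} P t.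
Arguments Pl {R} P t.
Arguments Pu {R} P t.
Arguments probl {R} P t.
Arguments probul {R} P t.
Arguments nestedV {R} P t x r.
Arguments nested_obj {R} P x1.
Arguments togo {R} P t Z u.
Arguments Q {R} P t x r.
Arguments calQ {R} P t x u.
Arguments reform_obj {R} P xu.

(* Main.v *)
Require Import Defs.
From HB Require Import structures.
From mathcomp Require Import all_boot all_order all_algebra.
From mathcomp Require Import all_classical all_reals all_analysis.
From mathcomp Require Import ring lra.
Import Order.TTheory GRing.Theory Num.Theory.
Import numFieldNormedType.Exports.
Local Open Scope classical_set_scope.
Local Open Scope ring_scope.

(** The heart of the matter is a one-stage duality. A distribution in the
ambiguity set is [fl + g] with [0 <= g <= fu - fl] and total mass
[\sum_r g r = 1 - Pl]: the mass [fl] is imposed, and the remaining [1 - Pl]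
can be spread freely under the caps [w = fu - fl]. Maximising [\sum_r g r * Z r]
over such [g] is a fractional knapsack problem, whose dual has one variable
[u], the multiplier of the mass constraint:
  max_g \sum_r g r * Z r
    = min_u (1 - Pl) * u + \sum_r w r * max (Z r - u) 0.
Weak duality ([capped_sum_le]) is a termwise inequality. For the equality
([capped_sum_attained]) one fills the outcomes greedily from the largest value
of [Z] downwards; the level [u] at which the mass runs out is a weighted
quantile of [Z] ([weighted_quantile]) and both sides agree there. Both optima
are thus attained.

Adding [\sum_r fl r * Z r], the dual objective is [(1 - Pl) * u + togo Z u], so
the worst-case expectation is the minimum over [u] of this quantity
([worst_le], [worst_attained]); rewritten with normalised weights, it is the
combination of expectation and CVaR ([worst_CVaR]).

Replacing in a minimisation over [x] an objective by a minimum over [u], in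
which the minimum is attained for every feasible [x], changes neither the
optimal value nor the optimal [x] ([optval_partial_min],
[argmin_partial_min]). Applied at stages [T], [T - 1], ..., 2 by backward
induction this gives [Q = nestedV] at feasible decisions, and applied once more
at the first stage it gives the equivalence. Boundedness of the recourse
function makes all the stage values finite, which is what the real-valued
duality needs. *)

(** * Duality for the fractional knapsack *)

(** The level [u] is the largest value of [Z] whose upper level set carries
weight at least [s]. Were the weight strictly above [u] more than [s], the
least value of [Z] above [u] would be a larger such level. *)
Lemma weighted_quantile (R : realFieldType) (I : finType) (w Z : I -> R)
    (s : R) :
    (forall i, 0 <= w i) -> 0 < s -> s <= \sum_i w i ->
  exists u, \sum_(i | u < Z i) w i <= s /\ s <= \sum_(i | u <= Z i) w i.
Proof.
move=> w_ge0 s_gt0 s_le.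
have [i0 _] : exists i : I, true.
  case: (pickP (fun _ : I => true)) => [i _|I0]; first by exists i.
  by move: s_le; rewrite big_pred0 // leNgt s_gt0.
pose ok i := s <= \sum_(j | Z i <= Z j) w j.
pose m := [arg min_(i < i0) Z i]%O.
have ok_m : ok m.
  rewrite /ok /m; case: arg_minP => // i _ Zi.
  by rewrite (eq_bigl xpredT) // => j; rewrite Zi.
pose k := [arg max_(i > m | ok i) Z i]%O.
have [ok_k max_k] : ok k /\ forall i, ok i -> Z i <= Z k.
  by rewrite /k; case: arg_maxP.
exists (Z k); split => //.
rewrite leNgt; apply/negP => lt_s.
have [j0 lt_j0] : exists j, Z k < Z j.
  case: (pickP (fun j => Z k < Z j)) => [j ?|I0]; first by exists j.
  by move: lt_s; rewrite big_pred0 // ltNge ltW.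
pose l := [arg min_(i < j0 | Z k < Z i) Z i]%O.
have [lt_l min_l] : Z k < Z l /\ forall i, Z k < Z i -> Z l <= Z i.
  by rewrite /l; case: arg_minP.
suff /max_k : ok l by rewrite leNgt lt_l.
rewrite /ok (eq_bigl (fun i => Z k < Z i)) ?ltW // => i.
by apply/idP/idP => [/(lt_le_trans lt_l)|/min_l].
Qed.

(** Weak duality: termwise, [g i * (Z i - u) <= w i * max (Z i - u) 0]. *)
Lemma capped_sum_le (R : realFieldType) (I : finType) (w g Z : I -> R)
    (s u : R) :
    (forall i, 0 <= g i <= w i) -> \sum_i g i = s ->
  \sum_i g i * Z i <= s * u + \sum_i w i * Num.max (Z i - u) 0.
Proof.
move=> g_bd <-; rewrite mulr_suml -big_split /=; apply: ler_sum => i _.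
have /andP[g0 gw] := g_bd i.
by case: (leP (Z i - u) 0) => ?; nra.
Qed.

(** Strong duality: with [u] a quantile, [g] takes the full cap where [Z > u],
nothing where [Z < u], and a fraction [th] of the cap where [Z = u], chosen so
that the total mass is [s]. Then [g i * (Z i - u) = w i * max (Z i - u) 0] for
every [i]. *)
Lemma capped_sum_attained (R : realFieldType) (I : finType) (w Z : I -> R)
    (s : R) :
    (forall i, 0 <= w i) -> 0 < s -> s <= \sum_i w i ->
  exists g u, [/\ forall i, 0 <= g i <= w i, \sum_i g i = s
    & \sum_i g i * Z i = s * u + \sum_i w i * Num.max (Z i - u) 0].
Proof.
move=> w_ge0 s_gt0 s_le.
have [u [above_le le_atleast]] := weighted_quantile R I w Z s w_ge0 s_gt0 s_le.
pose a := \sum_(i | u < Z i) w i; pose b := \sum_(i | Z i == u) w i.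
have atleastE : \sum_(i | u <= Z i) w i = a + b.
  rewrite (bigID (fun i => u < Z i)) /=; congr (_ + _); apply: eq_bigl => i.
    by rewrite andb_idl // => /ltW.
  by rewrite -leNgt eq_le andbC.
rewrite atleastE -/a in above_le le_atleast.
(* If [b = 0] then [s = a], and [th = 0 / 0 = 0] is still a valid fraction. *)
pose th := (s - a) / b.
have b_ge0 : 0 <= b by apply: sumr_ge0.
have th_b : th * b = s - a.
  rewrite /th; have [b0|b0] := eqVneq b 0; last by rewrite divfK.
  by rewrite b0 mulr0; lra.
have th_01 : 0 <= th <= 1.
  rewrite /th; have [->|b0] := eqVneq b 0; first by rewrite invr0 mulr0 lexx ler01.
  have b_gt0 : 0 < b by rewrite lt_neqAle eq_sym b0.
  by rewrite ler_pdivrMr // divr_ge0 ?subr_ge0 //= mul1r; lra.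
pose g i := if u < Z i then w i else if Z i == u then th * w i else 0.
have sum_g : \sum_i g i = s.
  have g_above : \sum_(i | u < Z i) g i = a.
    by apply: eq_bigr => i; rewrite /g => ->.
  have g_below : \sum_(i | ~~ (u < Z i)) g i = th * b.
    rewrite mulr_sumr [RHS]big_mkcond [LHS]big_mkcond; apply: eq_bigr => i _.
    rewrite /g; case: (ltgtP u (Z i)) => //=.
  by rewrite (bigID (fun i => u < Z i)) /= g_above g_below th_b; lra.
exists g, u; split => //.
  move=> i; rewrite /g; case: ifP => _; first by rewrite w_ge0 lexx.
  by have := w_ge0 i; case: ifP => _ ?; nra.
rewrite -sum_g mulr_suml -big_split /=; apply: eq_bigr => i _; rewrite /g.
case: (ltgtP (Z i) u) => [lt_Zu|lt_uZ|->]; last by rewrite subrr maxxx; lra.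
- by rewrite max_r; lra.
- by rewrite max_l; lra.
Qed.

(** * The worst-case expectation of a stage *)

Lemma norm_rV_le (R : realType) (n : nat) (f g : 'rV[R]_n) (d : R) :
    0 <= d ->
  `|f - g| <= d <-> forall r, g 0 r - d <= f 0 r <= g 0 r + d.
Proof.
move=> d0; rewrite [`|_|]mx_normrE; split=> [/bigmax_leP[_ H] r|H].
  by have := H (0, r) isT; rewrite /= !mxE ler_distl.
by apply/bigmax_leP; split=> // -[i r] _ /=; rewrite !mxE ord1 ler_distl.
Qed.

Definition stage_ok (R : realType) (P : program R) (t : nat) : Prop :=
  [/\ (t <= horizon P)%N, forall r, 0 <= fl P t 0 r, 0 < Pl P t < 1
    & 1 < Pu P t].

Section Stage.
Context (R : realType) (P : program R) (t : nat) (ok : stage_ok R P t).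
Local Notation K := (nscen P).
Local Notation w := (fun r : 'I_K => fu P t 0 r - fl P t 0 r).

Lemma PlE : Pl P t = \sum_(r < K) fl P t 0 r.
Proof. by case: ok => tT _ _ _; rewrite /Pl tT. Qed.

Lemma sum_gap : \sum_(r < K) w r = Pu P t - Pl P t.
Proof. by case: ok => tT _ _ _; rewrite sumrB /Pu /Pl tT. Qed.

Lemma gapE r : w r = tol P t *+ 2.
Proof. by rewrite /fu /fl !mxE; lra. Qed.

(** The gaps [fu - fl] all equal [2 * tol], and their sum [Pu - Pl] is
positive. *)
Lemma tol_ge0 : 0 <= tol P t.
Proof.
have : 0 < \sum_(r < K) w r by rewrite sum_gap; case: ok => _ _ ? ?; lra.
rewrite (eq_bigr (fun=> tol P t *+ 2)); last by move=> r _; exact: gapE.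
rewrite big_const_ord iter_addr addr0 => H.
by rewrite leNgt; apply/negP => lt0; move: H; rewrite ltNge !mulrn_wle0 ?ltW.
Qed.

(** Subtracting [fl] turns the ambiguity set into the feasible set of the
knapsack problem with caps [fu - fl] and mass [1 - Pl]. *)
Lemma ambiguityP (f : 'rV[R]_K) : ambiguity P t f <->
  (forall r, 0 <= f 0 r - fl P t 0 r <= w r) /\
  \sum_(r < K) (f 0 r - fl P t 0 r) = 1 - Pl P t.
Proof.
have box := norm_rV_le R K f (f0 P t) _ tol_ge0.
case: (ok) => _ fl0 _ _; rewrite sumrB -PlE; split=> [[f_ge0 /box fb f1]|[fb fs]].
  split; last by rewrite f1.
  by move=> r; have := fb r; rewrite /fu /fl !mxE; lra.
split; last by lra.
- by move=> r; have := fb r; have := fl0 r; lra.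
- by apply/box => r; have := fb r; rewrite /fu /fl !mxE; lra.
Qed.

Lemma expect_fin (p : 'rV[R]_K) (z : 'I_K -> R) :
  expect p (EFin \o z) = (\sum_(r < K) p 0 r * z r)%:E.
Proof. by rewrite /expect -sumEFin; apply: eq_bigr => r _; rewrite EFinM. Qed.

Lemma expect_pospart_fin (p : 'rV[R]_K) (z : 'I_K -> R) (u : R) :
  expect p (fun r => pospart ((EFin \o z) r - u%:E)%E) =
  (\sum_(r < K) p 0 r * Num.max (z r - u) 0)%:E.
Proof.
rewrite -expect_fin; congr (expect _ _); apply/funext => r /=.
by rewrite /pospart -EFinB EFin_max.
Qed.

(** The normalisations in [probl] and [probul] cancel against the factors
[Pl] and [Pu - Pl], both nonzero. *)
Lemma togo_fin (z : 'I_K -> R) (u : R) :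
  togo P t (EFin \o z) u =
  (\sum_(r < K) fl P t 0 r * z r +
   \sum_(r < K) w r * Num.max (z r - u) 0)%:E.
Proof.
rewrite /togo expect_fin expect_pospart_fin -!EFinM -EFinD; congr EFin.
have [Pl0 gap0] : Pl P t != 0 /\ Pu P t - Pl P t != 0.
  by case: (ok) => _ _ ? ?; split; apply: lt0r_neq0; lra.
rewrite !mulr_sumr; congr (_ + _); apply: eq_bigr => r _; rewrite !mxE.
  by rewrite !mulrA mulfV // mul1r.
by rewrite !mulrA mulfV // mul1r.
Qed.

Lemma worst_le (z : 'I_K -> R) (u : R) :
  (worst P t (EFin \o z) <= ((1 - Pl P t) * u)%:E + togo P t (EFin \o z) u)%E.
Proof.
apply: ge_ereal_sup => _ [f /ambiguityP[f_bd f_sum] <-].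
rewrite togo_fin expect_fin -EFinD lee_fin.
have := capped_sum_le R _ w _ z _ u f_bd f_sum.
under eq_bigr do rewrite mulrBl.
by rewrite sumrB; lra.
Qed.

Lemma worst_attained (z : 'I_K -> R) : exists u : R,
  worst P t (EFin \o z) = (((1 - Pl P t) * u)%:E + togo P t (EFin \o z) u)%E.
Proof.
have w_ge0 r : 0 <= w r by rewrite gapE mulrn_wge0 // tol_ge0.
have [s_gt0 s_le] : 0 < 1 - Pl P t /\ 1 - Pl P t <= \sum_(r < K) w r.
  by rewrite sum_gap; case: ok => _ _ ? ?; lra.
have [g [u [g_bd g_sum gz]]] :=
  capped_sum_attained R _ w z _ w_ge0 s_gt0 s_le.
exists u; apply/eqP; rewrite eq_le worst_le /=.
pose f := fl P t + \row_r g r.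
have fB r : f 0 r - fl P t 0 r = g r by rewrite !mxE; lra.
apply: ereal_sup_ubound; exists f.
  apply/ambiguityP; split=> [r|]; first by rewrite fB.
  by rewrite -g_sum; apply: eq_bigr => r _; rewrite fB.
rewrite togo_fin expect_fin -EFinD; congr EFin; rewrite addrCA -gz -big_split /=.
by apply: eq_bigr => r _; rewrite -fB; lra.
Qed.

(** For [alpha = (Pu - 1) / (Pu - Pl)] one has
[(1 - Pl) / (1 - alpha) = Pu - Pl], so that the function minimised in the
CVaR, scaled by [1 - Pl], is the dual objective of the stage. *)
Lemma scaled_CVaR_objective (z : 'I_K -> R) (u : R) :
  ((Pl P t)%:E * expect (probl P t) (EFin \o z) + (1 - Pl P t)%:E *
    (u%:E + ((1 - (Pu P t - 1) / (Pu P t - Pl P t))^-1)%:E *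
      expect (probul P t) (fun r => pospart ((EFin \o z) r - u%:E))))%E =
  (((1 - Pl P t) * u)%:E + togo P t (EFin \o z) u)%E.
Proof.
rewrite /togo expect_fin expect_pospart_fin -!(EFinM, EFinD); congr EFin.
have [s0 gap0] : 1 - Pl P t != 0 /\ Pu P t - Pl P t != 0.
  by case: (ok) => _ _ ? ?; split; apply: lt0r_neq0; lra.
by field; rewrite gap0 /=; apply: contra s0 => /eqP ?; apply/eqP; lra.
Qed.

(** Since the dual minimum is attained at a real level [u0], the infimum in the
CVaR is its value at [u0], and no exchange of infimum and affine map is
needed. *)
Lemma worst_CVaR (z : 'I_K -> R) :
  worst P t (EFin \o z) =
    ((Pl P t)%:E * expect (probl P t) (EFin \o z) +
     (1 - Pl P t)%:E *
       CVaR ((Pu P t - 1) / (Pu P t - Pl P t)) (probul P t) (EFin \o z))%E.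
Proof.
have s_gt0 : 0 < 1 - Pl P t by case: ok => _ _ ? ?; lra.
have [u0 u0E] := worst_attained z.
set alpha := (_ / _).
pose obj u := (u%:E + ((1 - alpha)^-1)%:E *
  expect (probul P t) (fun r => pospart ((EFin \o z) r - u%:E)))%E.
suff -> : CVaR alpha (probul P t) (EFin \o z) = obj u0.
  by rewrite scaled_CVaR_objective.
apply/eqP; rewrite eq_le; apply/andP; split.
  by apply: ereal_inf_lbound; exists u0.
apply: le_ereal_inf_tmp => _ [u _ <-].
have := worst_le z u; rewrite u0E -!scaled_CVaR_objective -/alpha -/(obj u).
rewrite expect_fin -EFinM leeD2lE // lee_pmul2l //.
Qed.

End Stage.

(** * Minimising out an auxiliary variable *)

Section PartialMin.
Context (R : realType) (X U : Type) (S : set X).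
Context (F : X -> \bar R) (G : X * U -> \bar R).
Context (F_le : forall x u, S x -> (F x <= G (x, u))%E).
Context (F_attained : forall x, S x -> exists u, F x = G (x, u)).

Lemma optval_partial_min : optval S F = optval (S `*` setT) G.
Proof.
apply/eqP; rewrite eq_le; apply/andP; split; apply: le_ereal_inf_tmp.
  move=> _ [[x u] [/= Sx _] <-]; apply: le_trans (F_le x u Sx).
  by apply: ereal_inf_lbound; exists x.
move=> _ [x Sx <-]; have [u ->] := F_attained x Sx.
by apply: ereal_inf_lbound; exists (x, u).
Qed.

Lemma argmin_partial_min : argmin S F = fst @` argmin (S `*` setT) G.
Proof.
apply/seteqP; split=> [x [Sx minx]|_ [[x u] [[/= Sx _] minx] <-]].
  have [u Fu] := F_attained x Sx; exists (x, u) => //; split=> // -[y v] [/= Sy _].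
  by rewrite -Fu; apply: le_trans (minx y Sy) (F_le y v Sy).
split=> // y Sy; have [v ->] := F_attained y Sy.
by apply: le_trans (F_le x u Sx) _; apply: minx.
Qed.

End PartialMin.

(** * Backward induction over the stages *)

Lemma bounded_fin (R : realType) (I : Type) (Z : I -> \bar R) (M : R) :
  (forall i, `|Z i| <= M%:E)%E -> exists z : I -> R, Z = EFin \o z.
Proof.
move=> ZM; exists (fine \o Z); apply/funext => i /=.
by rewrite fineK // fin_num_abs; apply: le_lt_trans (ZM i) (ltry M).
Qed.

Theorem mainTheorem1 (R : realType) (P : program R)
  (T_ge2 : (2 <= horizon P)%N)
  (f0_ge0 : forall t, (2 <= t <= horizon P)%N -> forall r, 0 <= f0 P t 0 r)
  (f0_sum1 : forall t, (2 <= t <= horizon P)%N ->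
    \sum_(r < nscen P) f0 P t 0 r = 1)
  (fl_ge0 : forall t, (2 <= t <= horizon P)%N -> forall r, 0 <= fl P t 0 r)
  (Pl_01 : forall t, (2 <= t <= horizon P)%N -> 0 < Pl P t < 1)
  (Pu_gt1 : forall t, (2 <= t <= horizon P)%N -> 1 < Pu P t)
  (* compact feasible set *)
  (X1_compact : compact (X1 P))
  (X_compact : forall t, (2 <= t <= horizon P)%N ->
    forall x : 'cV[R]_(dimx P t.-1), feasible P t.-1 x ->
    forall r, compact (Xset P t x r))
  (* relatively complete recourse *)
  (complete_recourse : forall t, (2 <= t <= horizon P)%N ->
    forall x : 'cV[R]_(dimx P t.-1), feasible P t.-1 x ->
    forall r, Xset P t x r !=set0)
  (* bounded recourse function *)
  (recourse_bounded : forall t, (2 <= t <= horizon P)%N ->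
    forall x : 'cV[R]_(dimx P t.-1), feasible P t.-1 x ->
    exists M : R, forall r, (`|nestedV P t x r| <= M%:E)%E) :
  [/\ optval (X1 P) (nested_obj P) = optval (X1 P `*` [set: R]) (reform_obj P),
      argmin (X1 P) (nested_obj P) =
        fst @` argmin (X1 P `*` [set: R]) (reform_obj P),
      forall t, (2 <= t <= horizon P)%N ->
        forall x : 'cV[R]_(dimx P t.-1), feasible P t.-1 x ->
        forall r, Q P t x r = nestedV P t x r
    & forall t, (2 <= t <= horizon P)%N ->
        forall x : 'cV[R]_(dimx P t.-1), feasible P t.-1 x ->
        worst P t (Q P t x) =
          ((Pl P t)%:E * expect (probl P t) (Q P t x) +
           (1 - Pl P t)%:E *
             CVaR ((Pu P t - 1) / (Pu P t - Pl P t)) (probul P t) (Q P t x))%E].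
Proof.
have ok t : (2 <= t <= horizon P)%N -> stage_ok R P t.
  by move=> tP; split; [case/andP: tP|exact: fl_ge0|exact: Pl_01|exact: Pu_gt1].
have V_fin t (tP : (2 <= t <= horizon P)%N) (x : 'cV[R]_(dimx P t.-1)) :
    feasible P t.-1 x -> exists z, nestedV P t x = EFin \o z.
  by move=> /(recourse_bounded t tP)[M]; apply: bounded_fin.
(* Backward induction on the stage, as induction on the number [k] of stages
   that remain after it. *)
have QV k : forall t, (2 <= t <= horizon P)%N -> (horizon P - t = k)%N ->
    forall x : 'cV[R]_(dimx P t.-1), feasible P t.-1 x ->
    Q P t x = nestedV P t x.
  elim: k => [|k IH] t tP tk x fx; apply/funext => r.
    have tT : t = horizon P.
      apply/eqP; rewrite eqn_leq -[(horizon P <= t)%N]subn_eq0 tk.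
      by case/andP: tP => _ ->.
    (* At the horizon the convention [Pl = 1] removes [u] from the objective. *)
    subst t; rewrite QE // nestedV_horizon; apply/esym/optval_partial_min.
      by move=> y u _; rewrite /calQ /Pl ltnn subrr mul0r /= !adde0.
    by move=> y _; exists 0; rewrite /calQ /Pl ltnn subrr mul0r /= !adde0.
  have ltT : (t < horizon P)%N by rewrite -subn_gt0 tk.
  have tP1 : (2 <= t.+1 <= horizon P)%N by case/andP: tP => /leqW -> _.
  have Q1 (y : 'cV[R]_(dimx P t)) : Xset P t x r y ->
      exists2 z, nestedV P t.+1 y = EFin \o z & Q P t.+1 y = EFin \o z.
    move=> xy; have fy : feasible P t y by apply: feasibleS fx xy.
    have [z zE] := V_fin t.+1 tP1 y fy; exists z => //.
    by rewrite -zE IH // subnS tk.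
  rewrite QE 1?ltnW // nestedVE //; apply/esym/optval_partial_min.
    move=> y u /Q1[z Vz Qz]; rewrite /calQ ltT /= Qz Vz -addeA leeD2l //.
    exact/worst_le/ok.
  move=> y /Q1[z Vz Qz]; have [u uE] := worst_attained R P _ (ok _ tP1) z.
  by exists u; rewrite /calQ ltT /= Qz Vz -addeA uE.
have two : (2 <= 2 <= horizon P)%N by [].
have Q2 (x : 'cV[R]_(dimx P 1)) : X1 P x ->
    exists2 z, nestedV P 2 x = EFin \o z & Q P 2 x = EFin \o z.
  move=> Xx; have fx : feasible P 1 x by apply: feasible1.
  have [z zE] := V_fin 2 two x fx; exists z => //.
  by rewrite -zE (QV _ 2 two erefl).
have obj_le (x : 'cV[R]_(dimx P 1)) (u : R) : X1 P x ->
    (nested_obj P x <= reform_obj P (x, u))%E.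
  move=> /Q2[z Vz Qz].
  rewrite /nested_obj /reform_obj /calQ T_ge2 /= Qz Vz -addeA leeD2l //.
  exact/worst_le/ok.
have obj_attained (x : 'cV[R]_(dimx P 1)) : X1 P x ->
    exists u : R, nested_obj P x = reform_obj P (x, u).
  move=> /Q2[z Vz Qz]; have [u uE] := worst_attained R P _ (ok _ two) z.
  by exists u; rewrite /nested_obj /reform_obj /calQ T_ge2 /= Qz Vz -addeA uE.
split.
- exact: optval_partial_min.
- exact: argmin_partial_min.
- by move=> t tP x fx r; rewrite (QV _ t tP erefl).
- move=> t tP x fx; have [z zE] := V_fin t tP x fx.
  rewrite (QV _ t tP erefl) // zE; exact/worst_CVaR/ok.
Qed.
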